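(* (Undirected version.) A finite simple undirected graph $H$ is isomorphic to the subgraph induced by the union of two of the three parts of the tripartition of some Eulerian undirected planar triangulation if and only if $H$ is $2$-vertex-connected, bipartite and planar. (Oriented version.) A finite oriented graph $H$ is isomorphic to the subdigraph induced by the union of two of the three parts of the tripartition of some Eulerian oriented planar triangulation if and only if the underlying undirected graph of $H$ is $2$-vertex-connected, bipartite and planar.
   Context: An oriented graph is a directed graph without directed cycles of length $1$ or $2$. An undirected graph is Eulerian if it is connected and all degrees are even; an oriented graph is Eulerian if it is connected and every vertex has in-degree equal to out-degree. A planar triangulation is a (finite, simple) planar graph all of whose faces, including the outer face, are triangles (the triangle $K_3$ is allowed); an oriented planar triangulation is an oriented graph whose underlying graph is a planar triangulation. An Eulerian (oriented) planar triangulation has a unique partition of its vertex set into three independent sets, called its tripartition. A graph is $2$-vertex-connected if it is connected, has at least two vertices, and has no cut-vertex (a vertex whose removal disconnects the graph); in particular the single edge $K_2$ counts as $2$-vertex-connected. *)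

(* Defs.v *)
From HB Require Import structures.
From mathcomp Require Import all_boot all_fingroup.

Set Implicit Arguments.
Unset Strict Implicit.
Unset Printing Implicit Defensive.

Record sgraph := SGraph {
  svertex :> finType;
  sedge : rel svertex;
  sedge_sym : symmetric sedge;
  sedge_irr : irreflexive sedge }.

Arguments sedge {s} _ _.

Record ograph := OGraph {
  overtex :> finType;
  arc : rel overtex;
  arc_irr : irreflexive arc;
  arc_asym : forall x y, arc x y -> ~~ arc y x }.

Arguments arc {o} _ _.

Section Underlying.
Variable D : ograph.

Definition under_edge : rel D := fun x y => arc x y || arc y x.

Lemma under_edge_sym : symmetric under_edge.
Proof. by move=> x y; rewrite /under_edge orbC. Qed.

Lemma under_edge_irr : irreflexive under_edge.
Proof. by move=> x; rewrite /under_edge arc_irr. Qed.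

Definition underlying : sgraph := SGraph under_edge_sym under_edge_irr.

End Underlying.

Section Induced.
Variables (G : sgraph) (S : {set G}).

Definition induced_edge : rel {x : G | x \in S} :=
  fun x y => sedge (val x) (val y).

Lemma induced_edge_sym : symmetric induced_edge.
Proof. by move=> x y; apply: sedge_sym. Qed.

Lemma induced_edge_irr : irreflexive induced_edge.
Proof. by move=> x; apply: sedge_irr. Qed.

Definition induced : sgraph := SGraph induced_edge_sym induced_edge_irr.

End Induced.

Section OInduced.
Variables (D : ograph) (S : {set D}).

Definition oinduced_arc : rel {x : D | x \in S} :=
  fun x y => arc (val x) (val y).

Lemma oinduced_arc_irr : irreflexive oinduced_arc.
Proof. by move=> x; apply: arc_irr. Qed.

Lemma oinduced_arc_asym x y : oinduced_arc x y -> ~~ oinduced_arc y x.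
Proof. exact: arc_asym. Qed.

Definition oinduced : ograph := OGraph oinduced_arc_irr oinduced_arc_asym.

End OInduced.

Definition sgraph_iso (G H : sgraph) : Prop :=
  exists f : G -> H,
    bijective f /\ forall x y : G, sedge (f x) (f y) = sedge x y.

Definition ograph_iso (D E : ograph) : Prop :=
  exists f : D -> E,
    bijective f /\ forall x y : D, arc (f x) (f y) = arc x y.

Definition connected (G : sgraph) : bool :=
  (0 < #|G|) && [forall x : G, forall y : G, connect sedge x y].

Definition cut_vertex (G : sgraph) (x : G) : bool :=
  ~~ connected (induced [set~ x]).

Definition two_vertex_connected (G : sgraph) : bool :=
  [&& connected G, 1 < #|G| & [forall x : G, ~~ cut_vertex x]].

Definition independent (G : sgraph) (S : {set G}) : bool :=
  [forall x in S, forall y in S, ~~ sedge x y].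

Definition bipartite (G : sgraph) : Prop :=
  exists S : {set G}, independent S /\ independent (~: S).

Definition tripartition (G : sgraph) (P : {set {set G}}) : Prop :=
  [/\ partition P [set: G], #|P| = 3 &
      forall A : {set G}, A \in P -> independent A].

Definition degree (G : sgraph) (x : G) : nat := #|[set y | sedge x y]|.

Definition eulerian (G : sgraph) : Prop :=
  connected G /\ forall x : G, ~~ odd (degree x).

Definition outdegree (D : ograph) (x : D) : nat := #|[set y | arc x y]|.
Definition indegree (D : ograph) (x : D) : nat := #|[set y | arc y x]|.

Definition oeulerian (D : ograph) : Prop :=
  connected (underlying D) /\ forall x : D, indegree x = outdegree x.

(* Plane drawings are represented, up to homeomorphism of the sphere, by     *)
(* combinatorial maps: the edges around each vertex are cyclically ordered,  *)
(* and the drawing is planar when Euler's formula holds.  On the sphere the  *)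
(* outer face is an ordinary face.                                           *)
Section CombinatorialMaps.
Variable G : sgraph.

(* A dart (x, y) is the edge xy seen from its endpoint x. *)
Definition dart : finType := {p : G * G | sedge p.1 p.2}.

Definition dart_source (d : dart) : G := (val d).1.

Lemma dart_opp_subproof (d : dart) : sedge (val d).2 (val d).1.
Proof. by rewrite sedge_sym (valP d). Qed.

Definition dart_opp (d : dart) : dart :=
  exist (fun p : G * G => sedge p.1 p.2)
        ((val d).2, (val d).1) (dart_opp_subproof d).

Lemma dart_oppK : involutive dart_opp.
Proof. by case=> [[x y] xy]; apply: val_inj. Qed.

Definition opp_perm : {perm dart} := perm (inv_inj dart_oppK).

(* The darts leaving a vertex form a single cycle of the rotation. *)
Record rotation_system := RotationSystem {
  rotation : {perm dart};
  rotationP : forall d : dart,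
    porbit rotation d = [set d' | dart_source d' == dart_source d] }.

Variable R : rotation_system.

(* Having followed (x, y), a facial walk leaves y along the dart that comes  *)
(* after (y, x) in the rotation at y.                                        *)
Definition face_perm : {perm dart} := (opp_perm * rotation R)%g.

(* A facial walk is the cyclic sequence of darts traversed by it. *)
Definition faces : {set {set dart}} := porbits face_perm.

Definition isolated : {set G} := [set x : G | [forall y : G, ~~ sedge x y]].

(* V + F = E + 2C, which says that every component has genus 0.  Faces are   *)
(* counted separately in each of the C components; a component reduced to a  *)
(* single vertex has one face, but no dart to account for it.                *)
Definition spherical : Prop :=
  #|G| + (#|faces| + #|isolated|)
    = #|porbits opp_perm| + 2 * n_comp (@sedge G) predT.

End CombinatorialMaps.

Definition planar (G : sgraph) : Prop :=
  exists R : rotation_system G, spherical R.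

(* Connectedness is implied when all the faces of a drawing are triangles,   *)
(* but not by its facial walks having length 3, as these are taken in each   *)
(* component separately.  The bound excludes K_1, which has no facial walk.  *)
Definition planar_triangulation (G : sgraph) : Prop :=
  [/\ connected G, 2 < #|G| &
      exists R : rotation_system G,
        spherical R /\ forall F, F \in faces R -> #|F| = 3].

Definition oriented_planar_triangulation (D : ograph) : Prop :=
  planar_triangulation (underlying D).

(* Main.v *)
Require Import Defs.
From mathcomp Require Import all_boot all_fingroup.
From mathcomp Require Import zify.
(* Restores [arc], which the path library also defines. *)
Import Defs.

Set Implicit Arguments.
Unset Strict Implicit.
Unset Printing Implicit Defensive.

(** If [G] is a triangulation with parts [A], [B], [C], every triangle has one
    vertex in each part, so around a vertex of [A] or [B] the neighbours in [C]
    alternate with the others.  Deleting [C] merges the triangles around each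
    vertex of [C] into one face, and counting gives Euler's formula for what is
    left ([deletion_planar]).  It is 2-connected because the neighbours of a
    vertex lie on a closed walk around it, so that walks can be rerouted first
    around a deleted vertex, then around [C] ([link_connected], [reroute],
    [deletion_two_vertex_connected]).

    Conversely, let [H] be drawn on the sphere, 2-connected and bipartite with
    sides [S] and its complement.  Put a new vertex in each face and join it to
    the corners of the face.  The result is a simple graph because a face of a
    2-connected drawing visits each vertex at most once ([face_visits_once]):
    otherwise splitting the vertex at two visits would give a map of negative
    genus, unless it is disconnected, in which case the vertex was a cut vertex.
    That the genus is nonnegative is [euler_inequality].  All the new faces are
    triangles ([cone_triangulation]), and the three parts are [S], its
    complement and the new vertices.  There are two triangles on each edge of
    [H], one of which is run through from [S] to its complement.  Each edge of
    the new graph lies on exactly one of these chosen triangles, so orienting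
    them as directed cycles, in the direction imposed by [H], gives every vertex
    equal in-degree and out-degree ([cone_eulerian]).  The undirected
    statement follows by orienting all the edges of [H] away from [S]. *)

(** * Orbits of permutations and the genus inequality *)

Lemma porbitS (T : finType) (p : {perm T}) x : p x \in porbit p x.
Proof. by have:= mem_porbit p 1 x; rewrite expg1. Qed.

Lemma porbit_trans (T : finType) (p : {perm T}) x y z :
  y \in porbit p x -> z \in porbit p y -> z \in porbit p x.
Proof. by rewrite -!eq_porbit_mem => /eqP-> /eqP->. Qed.

Lemma porbit_ind (T : finType) (p : {perm T}) (P : T -> Prop) x :
  P x -> (forall y, P y -> P (p y)) -> forall y, y \in porbit p x -> P y.
Proof.
move=> Px PS _ /porbitP[i ->]; elim: i => [|i IH]; first by rewrite expg0 perm1.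
by rewrite expgSr permM; apply: PS.
Qed.

(** The orbits are counted through an invariant that separates them: here the
    vertices of a drawing, and later the apexes of its triangles. *)
Lemma card_porbits_fibers (T V : finType) (p : {perm T}) (q : T -> V) :
  (forall t, q (p t) = q t) ->
  (forall t t', q t = q t' -> t' \in porbit p t) ->
  #|porbits p| = #|q @: [set: T]|.
Proof.
move=> q_inv q_orb; pose fiber v := [set t | q t == v].
have porbitE t : porbit p t = fiber (q t).
  apply/setP=> t'; rewrite inE; apply/idP/eqP => [|/esym/q_orb//].
  by apply: (porbit_ind (P := fun u => q u = q t)) => // u <-.
suff ->: porbits p = fiber @: (q @: [set: T]).
  rewrite card_in_imset // => _ _ /imsetP[t _ ->] /imsetP[t' _ ->].
  by rewrite -!porbitE => /eqP; rewrite eq_porbit_mem porbitE inE => /eqP.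
apply/setP=> X; apply/imsetP/imsetP => [[t _ ->]|[_ /imsetP[t _ ->] ->]].
  by exists (q t); rewrite ?imset_f ?porbitE.
by exists t; rewrite ?porbitE.
Qed.

Lemma partition_porbits (T : finType) (p : {perm T}) :
  partition (porbits p) [set: T].
Proof.
apply/and3P; split.
- apply/eqP/setP=> x; rewrite inE; apply/bigcupP.
  by exists (porbit p x); rewrite ?imset_f ?porbit_id.
- apply/trivIsetP=> _ _ /imsetP[x _ ->] /imsetP[y _ ->].
  apply: contraR => /pred0Pn[z /andP[/=]].
  by rewrite -!eq_porbit_mem => /eqP-> /eqP->.
- by apply/imsetP=> -[x _ x0]; have:= porbit_id p x; rewrite -x0 inE.
Qed.

Lemma card_porbits_uniform (T : finType) (p : {perm T}) k :
  (forall x, #|porbit p x| = k) -> #|porbits p| * k = #|T|.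
Proof.
move=> pk; rewrite -cardsT; symmetry.
apply: card_uniform_partition (partition_porbits p).
by move=> _ /imsetP[x _ ->].
Qed.

Lemma card_porbit_fcycle (T : finType) (p : {perm T}) x s :
  fcycle p s -> uniq s -> x \in s -> #|porbit p x| = size s.
Proof.
move=> ps us xs; rewrite -(order_cycle ps us xs); apply: eq_card => y.
apply/porbitP/idP => [[i ->]|/iter_findex <-].
  by rewrite permX; apply: fconnect_iter.
by exists (findex p x y); rewrite permX.
Qed.

Lemma card_porbit2 (T : finType) (p : {perm T}) x :
  p x != x -> p (p x) = x -> #|porbit p x| = 2.
Proof.
move=> px ppx; rewrite (@card_porbit_fcycle _ _ _ [:: x; p x]) //=.
- by rewrite ppx !eqxx.
- by rewrite inE eq_sym px.
- by rewrite inE eqxx.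
Qed.

Lemma card_porbit3 (T : finType) (p : {perm T}) x :
  p x != x -> p (p (p x)) = x -> #|porbit p x| = 3.
Proof.
move=> px pppx; rewrite (@card_porbit_fcycle _ _ _ [:: x; p x; p (p x)]) //=.
- by rewrite pppx !eqxx.
- have xpx : x != p x by rewrite eq_sym.
  have xppx : x != p (p x) by apply: contra px => /eqP xE; rewrite -{2}pppx -xE.
  by rewrite !inE negb_or (inj_eq perm_inj) xpx xppx.
- by rewrite inE eqxx.
Qed.

Lemma porbit_iter_id (T : finType) (p : {perm T}) x :
  #|porbit p x| = 3 -> p (p (p x)) = x.
Proof. by move=> h; have:= iter_porbit p x; rewrite h. Qed.

Lemma card_porbits_split (T : finType) (s : {perm T}) x y :
  x != y -> x \in porbit s y ->
  #|porbits (tperm x y * s)| = #|porbits s|.+1.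
Proof.
move=> xy sxy; have := porbits_mul_tperm s x y.
by rewrite /= sxy xy /= addn1 double0 addn0.
Qed.

Lemma card_porbits_merge (T : finType) (s : {perm T}) x y :
  x \notin porbit s y -> #|porbits (tperm x y * s)|.+1 = #|porbits s|.
Proof.
move=> nsxy; have := porbits_mul_tperm s x y.
have -> : x != y by apply: contraNneq nsxy => ->; apply: porbit_id.
by rewrite /= nsxy /= addn1 addn2 => -[].
Qed.

Lemma card_porbits_split_r (T : finType) (s : {perm T}) x y :
  x != y -> x \in porbit s y ->
  #|porbits (s * tperm x y)| = #|porbits s|.+1.
Proof.
move=> xy sxy; rewrite -porbitsV invMg tpermV -(porbitsV s).
by rewrite card_porbits_split ?porbitV.
Qed.

(** For the opposition of darts and a rotation, the components of this relation
    are those of the drawn graph, an isolated vertex having none. *)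
Definition either_step (T : finType) (a b : {perm T}) : rel T :=
  relU (frel a) (frel b).

Lemma either_step_sym (T : finType) (a b : {perm T}) : connect_sym (either_step a b).
Proof. by apply: relU_sym; apply: fconnect_sym; apply: perm_inj. Qed.

Lemma n_comp_all_connected (T : finType) (e : rel T) :
  connect_sym e -> (forall x y, connect e x y) -> n_comp e predT <= 1.
Proof.
move=> eC eT; apply/card_le1_eqP => x y /andP[/eqP<- _] /andP[/eqP<- _].
exact/rootP.
Qed.

Lemma sub_n_comp (T : finType) (e e' : rel T) :
  connect_sym e -> connect_sym e' -> (forall u v, e' u v -> connect e u v) ->
  n_comp e predT <= n_comp e' predT.
Proof.
move=> eC e'C e'e.
have inj : {in predI (roots e) predT &, injective (root e')}.
  move=> z z' /andP[/eqP rz _] /andP[/eqP rz' _] /(rootP e'C)/(connect_sub e'e).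
  by move/(rootP eC); rewrite rz rz'.
rewrite /n_comp_mem -(card_in_image inj); apply/subset_leq_card/subsetP.
by move=> _ /imageP[z _ ->]; rewrite inE /= roots_root.
Qed.

(** The hypothesis says that [e'] lies in the equivalence generated by [e] and
    the edge [x y].  Two components of [e] meeting the same component of [e']
    are those of [x] and [y], so leaving out the component of [x] makes the map
    to components of [e'] injective. *)
Lemma n_comp_add_edge (T : finType) (e e' : rel T) x y :
  connect_sym e -> connect_sym e' ->
  (forall u v, e' u v -> [|| connect e u v, connect e u x && connect e y v
                           | connect e u y && connect e x v]) ->
  n_comp e predT <= (n_comp e' predT).+1.
Proof.
move=> eC e'C e'e.
have step u v : connect e' u v -> [|| connect e u v,
    connect e u x && connect e y v | connect e u y && connect e x v].
  case/connectP=> p; elim/last_ind: p v => [|p w IH] v /=.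
    by move=> _ ->; rewrite connect0.
  rewrite rcons_path last_rcons => /andP[/IH/(_ erefl)] + /e'e + ->.
  move: (last u p) => z.
  case/or3P=> [uz|/andP[ux yz]|/andP[uy xz]].
  - by rewrite !(same_connect eC uz).
  - case/or3P=> [zw|/andP[zx yw]|/andP[zy xw]].
    + by rewrite ux (connect_trans yz zw) orbT.
    + by rewrite ux yw orbT.
    + by rewrite (connect_trans ux xw).
  - case/or3P=> [zw|/andP[zx yw]|/andP[zy xw]].
    + by rewrite uy (connect_trans xz zw) !orbT.
    + by rewrite (connect_trans uy yw).
    + by rewrite uy xw !orbT.
pose A := [pred z | (z != root e x) && roots e z].
have inj : {in A &, injective (root e')}.
  move=> z z' /andP[zx /eqP rz] /andP[z'x /eqP rz'] /(rootP e'C)/step.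
  case/or3P=> [/(rootP eC)|/andP[/(rootP eC)]|/andP[_ /(rootP eC)]].
  - by rewrite rz rz'.
  - by move=> E; rewrite -E rz eqxx in zx.
  - by move=> E; rewrite E rz' eqxx in z'x.
have: #|A| <= n_comp e' predT.
  rewrite /n_comp_mem -(card_in_image inj); apply/subset_leq_card/subsetP.
  by move=> _ /imageP[z _ ->]; rewrite inE /= roots_root.
rewrite -ltnS; apply: leq_trans.
rewrite /n_comp_mem (cardD1 (root e x)) inE /= (roots_root eC) add1n ltnS.
by apply/subset_leq_card/subsetP=> z; rewrite !inE andbT.
Qed.

Lemma porbit_either_step (T : finType) (a b : {perm T}) x y :
  y \in porbit (a * b) x -> connect (either_step a b) x y.
Proof.
apply: (porbit_ind (P := fun z => connect (either_step a b) x z)) => // z xz.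
apply: (connect_trans xz); rewrite permM.
by apply: (connect_trans (connect1 (y := a z) _) (connect1 _));
   rewrite /either_step /= eqxx ?orbT.
Qed.

(** The genus of a hypermap is nonnegative, in the form of Euler's formula
    counting the cycles of [a], [b] and [a * b].  Splitting a cycle of [a] by a
    transposition either splits a cycle of [a * b], and then cuts at most one
    component in two, or merges two cycles of [a * b] without disconnecting
    anything; this reduces the claim to [a = 1]. *)
Theorem euler_inequality (T : finType) (a b : {perm T}) :
  #|porbits a| + #|porbits b| + #|porbits (a * b)|
    <= #|T| + 2 * n_comp (either_step a b) predT.
Proof.
have [m] := ubnP #|[set z | a z != z]|; elim: m a => // m IH a /ltnSE-am.
have [fixa|] := boolP [forall z, a z == z].
  have -> : a = 1%g by apply/permP=> z; rewrite perm1; apply/eqP/(forallP fixa).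
  rewrite mul1g -addnA addnn -mul2n.
  have -> : #|porbits (1 : {perm T})%g| = #|T|.
    rewrite -(@card_porbits_uniform _ 1%g 1) ?muln1 // => x.
    by rewrite (@card_porbit_fcycle _ _ _ [:: x]) //= ?perm1 ?inE ?eqxx.
  rewrite leq_add2l leq_pmul2l //.
  rewrite (card_porbits_fibers (q := root (either_step 1 b))).
  - apply/subset_leq_card/subsetP=> _ /imsetP[x _ ->].
    by rewrite inE /= roots_root //; apply: either_step_sym.
  - move=> t; apply/esym/(rootP (@either_step_sym _ _ _))/connect1.
    by rewrite /either_step /= eqxx orbT.
  - move=> t t' /(rootP (@either_step_sym _ _ _))/connectP[p].
    elim/last_ind: p t' => [|p w IHp] t' /=; first by move=> _ ->; apply: porbit_id.
    rewrite rcons_path last_rcons => /andP[/IHp/(_ erefl) + step] ->.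
    case/orP: step => /eqP <- h; first by rewrite perm1.
    exact: porbit_trans h (porbitS _ _).
rewrite negb_forall => /existsP[x ax].
(* The permutation [a'] fixes [a x] and otherwise moves only points that [a]
   moves. *)
pose t := tperm x (a x); pose a' := (t * a)%g.
have xax : x != a x by rewrite eq_sym.
have Ea : a = (t * a')%g by rewrite mulgA tperm2 mul1g.
have a'_lt : #|[set z | a' z != z]| < m.
  apply: leq_trans am; apply/proper_card/properP; split.
    apply/subsetP=> z; rewrite !inE permM.
    by case: tpermP => [-> _ //|->|//]; rewrite eqxx.
  exists (a x); rewrite inE ?(inj_eq perm_inj) // permM tpermR eqxx.
  by [].
have := IH a' a'_lt.
have orb_a' : #|porbits a'| = #|porbits a|.+1.
  by rewrite card_porbits_split // porbit_sym porbitS.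
have step u v : either_step a b u v ->
    [|| connect (either_step a' b) u v,
        connect (either_step a' b) u x && connect (either_step a' b) (a x) v
      | connect (either_step a' b) u (a x) && connect (either_step a' b) x v].
  have a'1 z : connect (either_step a' b) z (a' z).
    by apply: connect1; rewrite /either_step /= eqxx.
  case/orP=> /eqP <-; last by rewrite (@connect1 _ _ u (b u)) // /either_step /= eqxx orbT.
  have -> : a u = a' (t u) by rewrite [in LHS]Ea permM.
  case: (tpermP x (a x) u : tperm_spec _ _ _ (t u)) => [->|->|_ _]; last by rewrite a'1.
    by rewrite connect0 a'1 orbT.
  by rewrite connect0 a'1 !orbT.
have [yx|nyx] := boolP (x \in porbit (a' * b) (a x)).
  have orb_ab : #|porbits (a * b)| = #|porbits (a' * b)|.+1.
    by rewrite {1}Ea -mulgA card_porbits_split.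
  have c_yx := porbit_either_step yx.
  have: n_comp (either_step a' b) predT <= n_comp (either_step a b) predT.
    apply: sub_n_comp; try exact: either_step_sym.
    move=> u v /step; have c_xy := c_yx; rewrite either_step_sym in c_xy.
    case/or3P=> [//|/andP[ux yv]|/andP[uy xv]].
      exact: connect_trans ux (connect_trans c_xy yv).
    exact: connect_trans uy (connect_trans c_yx xv).
  by lia.
have orb_ab : #|porbits (a * b)|.+1 = #|porbits (a' * b)|.
  by rewrite {1}Ea -mulgA card_porbits_merge.
have: n_comp (either_step a' b) predT <= (n_comp (either_step a b) predT).+1.
  by apply: n_comp_add_edge step; apply: either_step_sym.
by lia.
Qed.

Section Conjugation.
Variables (T U : finType) (p : {perm T}) (q : {perm U}) (h : T -> U).
Hypotheses (h_bij : bijective h) (hpq : forall t, h (p t) = q (h t)).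

Lemma porbit_conj t : porbit q (h t) = h @: porbit p t.
Proof.
apply/setP=> u; apply/idP/imsetP.
  apply: (porbit_ind (P := fun u => exists2 t', t' \in porbit p t & u = h t')).
    by exists t; rewrite ?porbit_id.
  move=> _ [t' tt' ->]; exists (p t') => //.
  exact: porbit_trans tt' (porbitS _ _).
case=> t' tt' ->; apply: (porbit_ind (P := fun t' => h t' \in porbit q (h t))) tt'.
  exact: porbit_id.
by move=> y ty; rewrite hpq; apply: porbit_trans ty (porbitS _ _).
Qed.

Lemma card_porbits_conj : #|porbits q| = #|porbits p|.
Proof.
rewrite -(card_imset _ (imset_inj (bij_inj h_bij))); congr #|pred_of_set _|.
have [g hK gK] := h_bij; apply/setP=> X; apply/imsetP/imsetP.
  by case=> u _ ->; exists (porbit p (g u)); rewrite ?imset_f // -porbit_conj gK.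
by case=> _ /imsetP[t _ ->] ->; exists (h t); rewrite ?porbit_conj.
Qed.

End Conjugation.

(** * Drawings of connected graphs *)

Section ConnectedGraphs.
Variable G : sgraph.

Lemma sedge_connect_sym : connect_sym (@sedge G).
Proof. exact/sym_connect_sym/sedge_sym. Qed.

Lemma sedge_neq (x y : G) : sedge x y -> x != y.
Proof. by apply: contraTneq => ->; rewrite sedge_irr. Qed.

Lemma connected_connect : connected G -> forall x y : G, connect sedge x y.
Proof. by case/andP=> _ /forallP cG x y; apply/forallP: y. Qed.

Lemma connectedI (x0 : G) : (forall x y : G, connect sedge x y) -> connected G.
Proof.
move=> cG; apply/andP; split; first by apply/card_gt0P; exists x0.
by apply/forallP=> x; apply/forallP=> y.
Qed.

Lemma connected_neighbor : connected G -> 1 < #|G| ->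
  forall x : G, exists y, sedge x y.
Proof.
move=> cG G2 x; have [y /= yx] : exists y, y \in predC1 x.
  by apply/card_gt0P; rewrite cardC1; case: #|G| G2 => [|[]].
case/connectP: (connected_connect cG x y) yx => -[|z p] /=.
  by move=> _ ->; rewrite !inE eqxx.
by case/andP=> xz _ _ _; exists z.
Qed.

Definition mk_dart (x y : G) (xy : sedge x y) : dart G :=
  exist (fun p : G * G => sedge p.1 p.2) (x, y) xy.

Lemma dart_eq (d d' : dart G) :
  dart_source d = dart_source d' ->
  dart_source (dart_opp d) = dart_source (dart_opp d') -> d = d'.
Proof.
case: d d' => [[x y] xy] [[x' y'] xy']; rewrite /dart_source /= => ex ey.
by apply: val_inj; rewrite /= ex ey.
Qed.

Lemma dart_edge (d : dart G) : sedge (dart_source d) (dart_source (dart_opp d)).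
Proof. exact: valP d. Qed.

Lemma opp_permE d : opp_perm G d = dart_opp d.
Proof. by rewrite permE. Qed.

Lemma card_dart : #|porbits (opp_perm G)| * 2 = #|dart G|.
Proof.
apply: card_porbits_uniform => d; apply: card_porbit2; rewrite !opp_permE.
  apply/eqP => /(congr1 (@dart_source G)) E.
  by have := dart_edge d; rewrite E sedge_irr.
exact: dart_oppK.
Qed.

Lemma rotation_source (R : rotation_system G) d :
  dart_source (rotation R d) = dart_source d.
Proof.
by have := porbitS (rotation R) d; rewrite (rotationP R) inE => /eqP.
Qed.

Lemma rotation_orbit (R : rotation_system G) d d' :
  dart_source d = dart_source d' -> d' \in porbit (rotation R) d.
Proof. by rewrite (rotationP R) inE => ->. Qed.

Lemma card_porbits_rotation (R : rotation_system G) :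
  connected G -> 1 < #|G| -> #|porbits (rotation R)| = #|G|.
Proof.
move=> cG G2; rewrite (card_porbits_fibers (q := @dart_source G)).
- rewrite -cardsT; congr #|pred_of_set _|; apply/setP=> x.
  rewrite inE; apply/imsetP; have [y xy] := connected_neighbor cG G2 x.
  by exists (mk_dart xy).
- exact: rotation_source.
- exact: rotation_orbit.
Qed.

(** Here there are no isolated vertices and the graph has one component, which
    turns [spherical] into the usual V + F = E + 2. *)
Lemma spherical_connected (R : rotation_system G) :
  connected G -> 1 < #|G| ->
  spherical R <-> #|G| + #|faces R| = #|porbits (opp_perm G)| + 2.
Proof.
move=> cG G2; rewrite /spherical.
have -> : isolated G = set0.
  apply/setP=> x; rewrite !inE; apply/negP=> /forallP isx.
  by have [y xy] := connected_neighbor cG G2 x; have:= isx y; rewrite xy.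
have [x _] : exists x : G, x \in predT by apply/card_gt0P; apply: ltnW.
have -> : n_comp (@sedge G) predT = 1.
  rewrite -(n_comp_connect sedge_connect_sym x); apply: eq_n_comp_r => y.
  by rewrite !inE; apply/esym/connected_connect.
by rewrite cards0 addn0.
Qed.

End ConnectedGraphs.

(** A drawing can be described on any finite type [T] of half-edges in bijection
    with the darts of [G]; its users need not build permutations of the
    darts, whose type depends on the edge relation. *)
Section AbstractMaps.
Variables (G : sgraph) (T : finType) (r o : {perm T}) (s : T -> G).
Hypotheses (oK : involutive o)
  (s_edge : forall t, sedge (s t) (s (o t)))
  (s_surj : forall x y, sedge x y -> exists2 t, s t = x & s (o t) = y)
  (s_inj : forall t t', s t = s t' -> s (o t) = s (o t') -> t = t')
  (s_r : forall t, s (r t) = s t)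
  (s_orb : forall t t', s t = s t' -> t' \in porbit r t).

Theorem abstract_map : exists R : rotation_system G,
  [/\ #|faces R| = #|porbits (o * r)|,
      #|porbits (opp_perm G)| = #|porbits o| &
      (forall t, #|porbit (o * r) t| = 3) ->
      forall F, F \in faces R -> #|F| = 3].
Proof.
pose h t := mk_dart (s_edge t).
have h_inj : injective h.
  by move=> t t' /(congr1 val)[]; apply: s_inj.
have h_surj d : exists t, h t == d.
  have [t st sot] := s_surj (dart_edge d); exists t; apply/eqP.
  exact: dart_eq.
pose g d := xchoose (h_surj d).
have gK : cancel g h by move=> d; apply/eqP/(xchooseP (h_surj d)).
have hK : cancel h g by move=> t; apply: h_inj; rewrite gK.
have h_bij : bijective h by exists g.
have rot_inj : injective (fun d => h (r (g d))).
  by move=> d d' /h_inj/perm_inj/(can_inj gK).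
have h_r t : h (r t) = perm rot_inj (h t) by rewrite permE hK.
have rotP d : porbit (perm rot_inj) d
    = [set d' | dart_source d' == dart_source d].
  rewrite -(gK d) (porbit_conj h_r); apply/setP=> d'.
  rewrite inE; apply/imsetP/eqP => [[t gt ->]|E].
    rewrite /dart_source /=.
    by apply: (porbit_ind (P := fun t => s t = s (g d))) gt => // t' <-.
  by exists (g d'); rewrite ?gK //; apply/s_orb/esym; rewrite -(gK d') in E.
have h_o t : h (o t) = opp_perm G (h t).
  by rewrite permE; apply: dart_eq; rewrite // /dart_source /= oK.
pose R := RotationSystem rotP; exists R.
have h_face t : h ((o * r)%g t) = face_perm R (h t).
  by rewrite !permM -h_o -h_r.
split.
- exact: (card_porbits_conj h_bij h_face).
- exact: (card_porbits_conj h_bij h_o).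
- move=> all3 _ /imsetP[d _ ->]; rewrite -(gK d) (porbit_conj h_face).
  by rewrite card_imset.
Qed.

End AbstractMaps.

(** * Faces of a 2-connected drawing *)

Lemma connect_homo (T U : finType) (e : rel T) (e' : rel U) (f : T -> U) :
  (forall x y, e x y -> connect e' (f x) (f y)) ->
  forall x y, connect e x y -> connect e' (f x) (f y).
Proof.
move=> fP x y /connectP[p]; elim/last_ind: p y => [|p z IH] y /=.
  by move=> _ ->.
rewrite rcons_path last_rcons => /andP[/IH/(_ erefl) xz /fP zy] ->.
exact: connect_trans xz zy.
Qed.

Definition avoiding (G : sgraph) (X : {set G}) : rel G :=
  fun x y => [&& sedge x y, x \notin X & y \notin X].

(** This replaces the induced subgraphs of the definition by walks in [G]. *)
Lemma two_vertex_connectedP (G : sgraph) :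
  two_vertex_connected G <->
  [/\ connected G, 1 < #|G| & forall v x y : G, x != v -> y != v ->
        connect (avoiding [set v]) x y].
Proof.
split=> [/and3P[cG G2 /forallP nocut]|[cG G2 nocut]].
  split=> // v x y xv yv; have := nocut v; rewrite /cut_vertex negbK.
  have Sx : x \in [set~ v] by rewrite !inE.
  have Sy : y \in [set~ v] by rewrite !inE.
  move=> /connected_connect/(_ (exist _ x Sx) (exist _ y Sy)).
  apply: (connect_homo (f := val)) => -[a Sa] [b Sb] /= ab.
  have := Sa; have := Sb; rewrite !inE => bv av.
  by apply: connect1; rewrite /avoiding !inE av bv !andbT.
apply/and3P; split=> //; apply/forallP=> v; rewrite /cut_vertex negbK.
have [w] : exists w, w \in predC1 v.
  by apply/card_gt0P; rewrite cardC1; case: #|G| G2 => [|[]].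
rewrite inE => wv; have Sw : w \in [set~ v] by rewrite !inE.
pose w' : induced [set~ v] := exist _ w Sw.
apply: (connectedI w') => x y.
have val_neq (z : induced [set~ v]) : val z != v by have := valP z; rewrite !inE.
pose g z : induced [set~ v] := insubd w' z.
have gK z : g (val z) = z by apply: valKd.
rewrite -(gK x) -(gK y).
apply: (connect_homo (f := g)) (nocut v _ _ (val_neq x) (val_neq y)).
move=> a b /and3P[ab av bv]; apply: connect1.
by rewrite /= /induced_edge !val_insubd !inE in av bv *; rewrite av bv.
Qed.

(** If a face visits a vertex [v] twice, then [v] can be split in two at these
    visits; this also splits the face.  Counting vertices and faces, the result
    violates the Euler inequality unless it is disconnected, and then removing
    [v] disconnects the graph. *)
Theorem face_visits_once (G : sgraph) (R : rotation_system G) :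
  two_vertex_connected G -> spherical R ->
  forall d d', dart_source d = dart_source d' ->
    d' \in porbit (face_perm R) d -> d = d'.
Proof.
case/two_vertex_connectedP=> cG G2 nocut sphR d d' dd' face_dd'.
apply/eqP/negPn/negP => neq_dd'.
have {sphR} euler := proj1 (spherical_connected R cG G2) sphR.
(* Multiplying by the transposition splits the cycle at [v] between [d] and [d'],
   and at the same time the facial cycle through both. *)
set v := dart_source d in dd'; pose r := (rotation R * tperm d d')%g.
have vtx_split : #|porbits r| = #|G|.+1.
  rewrite card_porbits_split_r ?card_porbits_rotation //.
  exact/rotation_orbit/esym.
have face_split : #|porbits (opp_perm G * r)| = #|faces R|.+1.
  by rewrite mulgA card_porbits_split_r // porbit_sym.
pose e := either_step (opp_perm G) r.
have eC : connect_sym e by apply: either_step_sym.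
have e_opp x : connect e x (dart_opp x).
  by apply: connect1; rewrite /e /either_step /= opp_permE eqxx.
have e_rot x y : dart_source x != v -> dart_source x = dart_source y ->
    connect e x y.
  move=> xv xy; apply: proj2 (porbit_ind (P := fun y =>
      dart_source y = dart_source x /\ connect e x y) (x := x) _ _
      (rotation_orbit R xy)) => //.
  move=> z [zx cz]; rewrite rotation_source; split=> //.
  apply: (connect_trans cz); apply: connect1.
  have rz : r z = rotation R z.
    by rewrite permM tpermD //; apply: contraNneq xv => E;
      rewrite -zx -(rotation_source R) -E -?dd'.
  by rewrite /e /either_step /= rz eqxx orbT.
have e_walk x y : dart_source x != v -> dart_source y != v -> connect e x y.
  move=> xv yv; pose P a := forall z, dart_source z = a -> connect e x z.
  suff: P (dart_source y) by apply.
  have := nocut v _ _ xv yv; case/connectP=> p.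
  elim/last_ind: p (dart_source y) => [|p w IH] b /=.
    by move=> _ -> z zx; apply: e_rot.
  rewrite rcons_path last_rcons => /andP[/IH/(_ erefl) + aw] -> z zw.
  move: aw; set a := last _ _; case/and3P=> aw; rewrite !inE => av wv.
  move/(_ (mk_dart aw) erefl) => xaw.
  apply: (connect_trans xaw); apply: (connect_trans (e_opp _)).
  exact: e_rot.
have e_out x : exists2 y, connect e x y & dart_source y != v.
  have [xv|] := eqVneq (dart_source x) v; last by exists x.
  by exists (dart_opp x) => //; rewrite -xv eq_sym; apply/sedge_neq/dart_edge.
have: n_comp e predT <= 1.
  apply: n_comp_all_connected => // x y.
  have [x' xx' x'v] := e_out x; have [y' yy' y'v] := e_out y.
  by rewrite (same_connect eC xx') (same_connect_r eC yy') e_walk.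
have := euler_inequality (opp_perm G) r.
rewrite -/e vtx_split face_split -card_dart.
by lia.
Qed.

(** * Deleting one part of a triangulation *)

Lemma independentP (G : sgraph) (S : {set G}) :
  reflect (forall x y, x \in S -> y \in S -> ~~ sedge x y) (independent S).
Proof.
apply: (iffP forallP) => [indS x y xS yS|indS x].
  by have := indS x; rewrite xS => /forallP/(_ y); rewrite yS.
by apply/implyP=> xS; apply/forallP=> y; apply/implyP=> yS; apply: indS.
Qed.

(** As [Z] is independent, a walk that enters [Z] at [z] leaves it at once for
    another neighbour of [z], and the detour joins the two neighbours. *)
Lemma reroute (G : sgraph) (X Z : {set G}) :
  independent Z ->
  (forall z u w, z \in Z -> z \notin X -> sedge z u -> sedge z w ->
     u \notin X -> w \notin X -> connect (avoiding (X :|: Z)) u w) ->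
  forall x y, x \notin X :|: Z -> y \notin X :|: Z ->
    connect (avoiding X) x y -> connect (avoiding (X :|: Z)) x y.
Proof.
move=> /independentP indZ detour x y xXZ yXZ /connectP[p].
have Zout z u : z \in Z -> sedge z u -> u \notin Z.
  by move=> zZ; apply: contraTN; apply: indZ.
have /norP[xX xZ] : ~~ ((x \in X) || (x \in Z)) by move: xXZ; rewrite inE.
have /norP[_ yZ] : ~~ ((y \in X) || (y \in Z)) by move: yXZ; rewrite inE.
suff main : forall a, a \notin X -> path (avoiding X) a p -> y = last a p ->
    (a \notin Z -> connect (avoiding (X :|: Z)) a y) /\
    (a \in Z -> forall u, sedge a u -> u \notin X ->
       connect (avoiding (X :|: Z)) u y).
  by move=> xp yE; apply: (proj1 (main x xX xp yE)).
elim: p {x xXZ xX xZ} => [|b p IH] a aX /=.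
  by move=> _ yE; split=> [_|aZ]; rewrite yE // in yZ *; rewrite aZ in yZ.
case/andP=> /and3P[ab _ bX] bp yE; have [IHout IHin] := IH b bX bp yE.
split=> [aZ|aZ u au uX].
  have [bZ|bZ] := boolP (b \in Z); first by apply: IHin; rewrite // sedge_sym.
  apply: connect_trans (IHout bZ); apply: connect1.
  by rewrite /avoiding ab !inE !negb_or aX aZ bX bZ.
by apply: connect_trans (IHout (Zout _ _ aZ ab)); apply: (detour a).
Qed.

Section Triangulation.
Variables (G : sgraph) (R : rotation_system G).
Hypothesis faces3 : forall F, F \in faces R -> #|F| = 3.

Local Notation src := (@dart_source G).
Local Notation opp := (@dart_opp G).
Local Notation rot := (rotation R).
Local Notation next := (face_perm R).

Lemma nextE d : next d = rot (opp d).
Proof. by rewrite permM opp_permE. Qed.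

Lemma next_src d : src (next d) = src (opp d).
Proof. by rewrite nextE rotation_source. Qed.

Lemma next3 d : next (next (next d)) = d.
Proof. by apply: porbit_iter_id; apply: faces3; apply: imset_f. Qed.

Lemma next2_tgt d : src (opp (next (next d))) = src d.
Proof. by rewrite -next_src next3. Qed.

Lemma next_edge d : sedge (src (opp (next d))) (src d).
Proof. by rewrite -[X in sedge _ X]next2_tgt -next_src; apply: dart_edge. Qed.

Lemma rot_tgt d : src (opp (rot d)) = src (opp (next (opp d))).
Proof. by rewrite nextE dart_oppK. Qed.

Lemma rot_edge d : sedge (src (opp (rot d))) (src (opp d)).
Proof. by rewrite rot_tgt next_edge. Qed.

(** The triangles around [z] form a wheel: the neighbours of [z] lie on a
    closed walk, and remain connected when one of them is removed. *)
Lemma link_connected (z v u w : G) :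
  sedge z u -> sedge z w -> u != v -> w != v ->
  connect [rel a b | [&& sedge a b, sedge z a, sedge z b, a != v & b != v]] u w.
Proof.
set e := [rel a b | _] => zu zw uv wv.
have eC : connect_sym e.
  apply/sym_connect_sym => a b; rewrite /= sedge_sym.
  by rewrite [(a != v) && _]andbC [sedge z a && _]andbCA.
(* If [v] is a neighbour, start the tour of [z] just after [v], so that [v] comes
   last; otherwise start anywhere. *)
have [d dz d_v] : exists2 d, src d = z &
    forall d', src d' = z -> src (opp d') = v -> d' = d.
  have [zv|zv] := boolP (sedge z v).
    by exists (mk_dart zv) => // d' d'z d'v; apply: dart_eq.
  exists (mk_dart zu) => // d' d'z d'v.
  by case/negP: zv; rewrite -d'z -d'v dart_edge.
have reach d' : src d' = z -> src (opp d') != v ->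
    connect e (src (opp (rot d))) (src (opp d')).
  move=> d'z; have : d' \in porbit rot (rot d).
    by apply: rotation_orbit; rewrite rotation_source dz d'z.
  move/(porbit_ind (P := fun x => src x = z /\ (src (opp x) != v ->
    connect e (src (opp (rot d))) (src (opp x))))) => [] //.
    by rewrite rotation_source.
  move=> x [xz IH]; rewrite rotation_source; split=> // rxv.
  have [xv|xv] := eqVneq (src (opp x)) v; first by rewrite (d_v x xz xv).
  apply: connect_trans (IH xv) (connect1 _).
  rewrite /e /= xv rxv sedge_sym rot_edge -xz dart_edge.
  by rewrite -[X in sedge X _](rotation_source R) dart_edge.
apply: (@connect_trans _ _ (src (opp (rot d)))); last exact: (reach (mk_dart zw)).
by rewrite eC; apply: (reach (mk_dart zu)).
Qed.

Hypothesis connG : connected G.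

Lemma connect_avoiding1 (v x y : G) : x != v -> y != v ->
  connect (avoiding [set v]) x y.
Proof.
move=> xv yv; rewrite -[[set v]]set0U; apply: reroute; rewrite ?inE //.
- apply/independentP=> a b /set1P-> /set1P->; by rewrite sedge_irr.
- move=> z u w /set1P-> _ vu vw _ _; rewrite set0U.
  have ne a : sedge v a -> a != v by move=> va; rewrite eq_sym sedge_neq.
  apply: (connect_homo (f := id)) (link_connected vu vw (ne _ vu) (ne _ vw)).
  move=> a b /and5P[ab _ _ av bv]; apply: connect1.
  by rewrite /avoiding ab !inE av bv.
- rewrite (eq_connect (e' := sedge)) ?connected_connect // => a b.
  by rewrite /avoiding !inE !andbT.
Qed.

Variable C : {set G}.
Hypotheses (indC : independent C) 
  (C_triangle : forall x y z, sedge x y -> sedge y z -> sedge z x ->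
     x \notin C -> y \notin C -> z \in C).

Lemma neighborC z u : z \in C -> sedge z u -> u \notin C.
Proof. by move=> zC; apply: contraTN; apply: (independentP _ indC). Qed.

Lemma next_tgtC d : src d \notin C -> src (opp d) \notin C ->
  src (opp (next d)) \in C.
Proof.
apply: C_triangle (next_edge d); first exact: dart_edge.
by rewrite -next_src dart_edge.
Qed.

(** The link of a vertex of [C] contains no vertex of [C], so it also survives
    the deletion of the rest of [C]; [X] holds at most one other vertex. *)
Lemma link_avoiding (X : {set G}) z u w : z \in C -> sedge z u -> sedge z w ->
  u \notin X -> w \notin X -> #|X| <= 1 ->
  connect (avoiding (X :|: C)) u w.
Proof.
move=> zC zu zw uX wX /card_le1_eqP X1.
pose v := odflt z [pick x in X].
have Xv x : x \in X -> x = v.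
  by rewrite /v; case: pickP => [y yX xX|/(_ x) ->//]; apply: X1.
have vX a : sedge z a -> a \notin X -> a != v.
  rewrite /v; case: pickP => /= [y yX _|_ za _]; first by apply: contraNneq => ->.
  by rewrite eq_sym; apply: sedge_neq.
apply: (connect_homo (f := id)) (link_connected zu zw (vX _ zu uX) (vX _ zw wX)).
move=> a b /and5P[ab za zb av bv]; apply: connect1.
rewrite /avoiding ab !inE !negb_or (neighborC zC za) (neighborC zC zb) !andbT.
by rewrite /=; apply/andP; split; [move: av|move: bv]; apply: contraNN => /Xv ->.
Qed.

Lemma connect_avoidingC (X : {set G}) x y : #|X| <= 1 ->
  x \notin X :|: C -> y \notin X :|: C -> connect (avoiding (X :|: C)) x y.
Proof.
move=> X1 xXC yXC; apply: reroute => //.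
  by move=> z u w zC _ zu zw uX wX; apply: link_avoiding zC _ _ _ _ _.
have [X0|[v vX]] := set_0Vmem X.
  rewrite X0 (eq_connect (e' := sedge)) ?connected_connect // => a b.
  by rewrite /avoiding !inE !andbT.
have Xv : X = [set v].
  by apply/eqP; rewrite eq_sym eqEcard sub1set vX cards1.
rewrite !inE !negb_or in xXC yXC.
rewrite Xv; apply: connect_avoiding1.
  by case/andP: xXC; rewrite Xv inE.
by case/andP: yXC; rewrite Xv inE.
Qed.

Variables (H : sgraph) (f : H -> G).
Hypotheses (f_inj : injective f) (f_edge : forall x y, sedge (f x) (f y) = sedge x y)
  (fC : forall x, f x \notin C) (f_surj : forall z, z \notin C -> exists x, f x = z)
  (H2 : 1 < #|H|).

Lemma inverse_exists : exists g : G -> H,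
  cancel f g /\ forall z, z \notin C -> f (g z) = z.
Proof.
have [x0 _] : exists x : H, x \in predT by apply/card_gt0P; apply: ltnW.
pose g z := odflt x0 [pick x | f x == z].
have fgz z : z \notin C -> f (g z) = z.
  case/f_surj=> x xz; rewrite /g; case: pickP => [y /eqP//|/(_ x)].
  by rewrite xz eqxx.
by exists g; split=> // x; apply: f_inj; rewrite fgz.
Qed.

Lemma deletion_two_vertex_connected : two_vertex_connected H.
Proof.
have [g [gK fgK]] := inverse_exists.
have down (X : {set G}) (Y : {set H}) x y : #|X| <= 1 ->
    (forall x, f x \in X = (x \in Y)) -> x \notin Y -> y \notin Y ->
    connect (avoiding Y) x y.
  move=> X1 XY xY yY; rewrite -(gK x) -(gK y).
  have: connect (avoiding (X :|: C)) (f x) (f y).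
    by apply: connect_avoidingC; rewrite // inE negb_or fC XY ?xY ?yY.
  apply: (connect_homo (f := g)) => a b; rewrite /avoiding !inE !negb_or.
  case/and3P=> ab /andP[aX aC] /andP[bX bC].
  by apply: connect1; rewrite -f_edge -!XY !fgK // ab aX bX.
have [x0 _] : exists x : H, x \in predT by apply/card_gt0P; apply: ltnW.
apply/two_vertex_connectedP; split=> // [|v x y xv yv].
  apply: (connectedI x0) => x y.
  have: connect (avoiding set0) x y.
    by apply: (down set0); rewrite ?cards0 ?inE // => a; rewrite !inE.
  by apply: (connect_homo (f := id)) => a b /and3P[ab _ _]; apply: connect1.
apply: (down [set f v]); rewrite ?cards1 ?inE // => a.
by rewrite !inE (inj_eq f_inj).
Qed.

Hypotheses (sphR : spherical R) (G2 : 1 < #|G|).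

Definition kept (d : dart G) : bool := (src d \notin C) && (src (opp d) \notin C).

Lemma kept_opp d : kept (opp d) = kept d.
Proof. by rewrite /kept dart_oppK andbC. Qed.

Lemma rot_tgtC d : src d \notin C ->
  (src (opp (rot d)) \in C) = (src (opp d) \notin C).
Proof.
move=> dC; have [tC|tC] := boolP (src (opp d) \in C).
  by apply/negbTE; apply: neighborC tC _; rewrite sedge_sym rot_edge.
by rewrite rot_tgt next_tgtC ?dart_oppK.
Qed.

Lemma kept_rot2 d : kept d -> kept (rot (rot d)).
Proof.
case/andP=> dC tC; rewrite /kept !rotation_source dC /=.
by rewrite rot_tgtC ?rotation_source // rot_tgtC // tC.
Qed.

Lemma next_kept d : kept d = (src (opp (next d)) \in C).
Proof.
apply/idP/idP => [/andP[dC tC]|zC]; first exact: next_tgtC.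
rewrite /kept (neighborC zC (next_edge d)) (neighborC zC) //.
by rewrite sedge_sym -(next_src d) dart_edge.
Qed.

(** The facial permutation runs through the three darts of a triangle in turn:
    one avoids [C], the next enters [C] and the last leaves it. *)
Lemma card_kept : #|dart G| = 3 * #|[set d | kept d]|.
Proof.
pose from := [set d | src d \in C]; pose into := [set d | src (opp d) \in C].
have E1 : #|into| = #|[set d | kept d]|.
  rewrite -(card_preimset _ (perm_inj (s := next))).
  by apply: eq_card => d; rewrite !inE next_kept.
have E2 : #|from| = #|into|.
  rewrite -(card_preimset _ (inv_inj (@dart_oppK G))).
  by apply: eq_card => d; rewrite !inE.
rewrite -cardsT -(cardsID from) setTI -(cardsID into (_ :\: _)).
have -> : ([set: dart G] :\: from) :&: into = into.
  apply/setP=> d; rewrite !inE; case: (boolP (src (opp d) \in C)) => [tC|_];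
    last by rewrite andbF.
  by rewrite andbT (neighborC tC) // sedge_sym dart_edge.
have -> : ([set: dart G] :\: from) :\: into = [set d | kept d].
  by apply/setP=> d; rewrite !inE andbT andbC.
by rewrite E2 E1 addnA addnC !mulSn mul0n addn0.
Qed.

(** Deleting [C] merges the triangles around each of its vertices into one
    face, so the faces of the new drawing correspond to the vertices of [C].
    The rotation skips every other dart, since around a remaining vertex the
    triangles make vertices of [C] alternate with others. *)
Lemma deletion_planar : planar H.
Proof.
have [g [gK fgK]] := inverse_exists.
pose T : finType := {d : dart G | kept d}.
pose rT (t : T) : T := exist (fun d => kept d) _ (kept_rot2 (valP t)).
have oT_proof (t : T) : kept (opp (val t)) by rewrite kept_opp (valP t).
pose oT (t : T) : T := exist (fun d => kept d) _ (oT_proof t).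
have rT_inj : injective rT.
  by move=> t t' /(congr1 val)/perm_inj/perm_inj/val_inj.
have oTK : involutive oT by move=> t; apply: val_inj; rewrite /= dart_oppK.
pose r := perm rT_inj; pose o := perm (inv_inj oTK).
pose s (t : T) := g (src (val t)).
have fs t : f (s t) = src (val t) by apply: fgK; case/andP: (valP t).
have vo t : val (o t) = opp (val t) by rewrite permE.
have vr t : val (r t) = rot (rot (val t)) by rewrite permE.
have oK : involutive o by move=> t; apply: val_inj; rewrite !vo dart_oppK.
have [|||||R' [facesR' oppR' _]] := @abstract_map H T r o s oK.
- by move=> t; rewrite -f_edge !fs vo dart_edge.
- move=> x y; rewrite -f_edge => xy.
  have xyP : kept (mk_dart xy) by rewrite /kept /dart_source /= !fC.
  exists (exist (fun d => kept d) _ xyP); apply: f_inj; rewrite fs //.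
  by rewrite vo.
- move=> t t' /(congr1 f); rewrite !fs => st /(congr1 f).
  by rewrite !fs !vo => st'; apply/val_inj/dart_eq.
- by move=> t; apply: f_inj; rewrite !fs vr !rotation_source.
- move=> t t' /(congr1 f); rewrite !fs => /(rotation_orbit R)/porbitP[n].
  have alternate m : (src (opp ((rot ^+ m)%g (val t))) \in C) = odd m
      /\ src ((rot ^+ m)%g (val t)) = src (val t).
    elim: m => [|m [IH IHs]]; first by rewrite expg0 perm1; split=> //;
      apply/negbTE; case/andP: (valP t).
    rewrite expgSr permM rotation_source IHs; split=> //.
    by rewrite rot_tgtC ?IH // IHs; case/andP: (valP t).
  move=> E; have := (alternate n).1; rewrite -E.
  have /andP[_ /negbTE->] := valP t'; move=> /esym/negbT n_even.
  have {}E : t' = (r ^+ n./2)%g t.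
    apply: val_inj; rewrite E -(even_halfK n_even).
    elim: n./2 => [|m IH]; first by rewrite !expg0 !perm1.
    by rewrite doubleS !expgSr !permM vr IH.
  by rewrite E mem_porbit.
exists R'.
have /two_vertex_connectedP[cH _ _] := deletion_two_vertex_connected.
apply/spherical_connected => //; rewrite facesR' oppR'.
(* The third dart of the triangle of [t], which leaves its vertex in [C]. *)
pose apex (t : T) := next (next (val t)).
have apexC t : src (apex t) \in C.
  by rewrite next_src -next_kept (valP t).
(* A step along a face of the new drawing is a step backwards in the rotation at
   the deleted vertex. *)
have apex_step t : rot (apex ((o * r)%g t)) = apex t.
  have rot_next d : rot (next d) = next (opp (next d))
    by rewrite (nextE (opp _)) dart_oppK.
  by rewrite /apex permM vr vo -(nextE (val t)) (rot_next (val t)) next3 -nextE.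
have o_r_faces : #|porbits (o * r)| = #|C|.
  rewrite (card_porbits_fibers (q := fun t => src (apex t))).
  - apply: eq_card => z; apply/imsetP/idP => [[t _ ->]//|zC].
    have [w zw] := connected_neighbor connG G2 z.
    have kd : kept (next (mk_dart zw)).
      by rewrite next_kept next2_tgt.
    by exists (exist (fun d => kept d) _ kd) => //; rewrite /apex /= next3.
  - by move=> t; rewrite -(rotation_source R) apex_step.
  - move=> t t' /esym/(rotation_orbit R)/porbitP[n E]; apply/porbitP; exists n.
    apply: val_inj; apply: (@perm_inj _ next); apply: (@perm_inj _ next).
    apply: (@perm_inj _ (rot ^+ n)%g); rewrite -/(apex _) -E -/(apex _).
    elim: n {E} => [|n IH]; first by rewrite !expg0 !perm1.
    rewrite (expgS rot) permM (expgSr (o * r)%g) (permM _ (o * r)%g).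
    by rewrite apex_step.
have o2 : #|porbits o| * 2 = #|[set d | kept d]|.
  rewrite (card_porbits_uniform (k := 2)) ?card_sig ?cardsE //.
  move=> t; apply: card_porbit2 (oK t); apply/eqP => /(congr1 (f \o s)) /=.
  by rewrite !fs vo => /eqP; rewrite eq_sym (negbTE (sedge_neq (dart_edge _))).
have cardH : #|H| = #|~: C|.
  rewrite -(card_codom f_inj); apply: eq_card => z; rewrite inE.
  by apply/codomP/idP => [[x ->]|/f_surj[x <-]]; [apply: fC|exists x].
have faces3G : #|faces R| * 3 = #|dart G|.
  by apply: card_porbits_uniform => d; apply/faces3/imset_f.
have := proj1 (spherical_connected R connG G2) sphR.
have := card_dart G; have := card_kept; have := cardsC C.
by rewrite o_r_faces cardH; lia.
Qed.

End Triangulation.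

(** * Oriented graphs given by bundles of half-edges *)

Section MapGraph.
Variables (V T : finType) (s : T -> V) (o : {perm T}) (out : pred T).
Hypotheses (oK : involutive o) (s_loop : forall t, s t != s (o t))
  (s_inj : forall t t', s t = s t' -> s (o t) = s (o t') -> t = t')
  (out_o : forall t, out (o t) = ~~ out t).

Definition map_arc : rel V :=
  fun x y => [exists t, [&& s t == x, s (o t) == y & out t]].

Lemma map_arcP x y :
  reflect (exists t, [/\ s t = x, s (o t) = y & out t]) (map_arc x y).
Proof.
apply: (iffP existsP) => -[t]; first by case/and3P=> /eqP ? /eqP ? ?; exists t.
by case=> sx sy ot; exists t; rewrite sx sy ot !eqxx.
Qed.

Lemma map_arc_irr : irreflexive map_arc.
Proof.
by move=> x; apply/map_arcP=> -[t [<- /eqP]]; rewrite eq_sym (negbTE (s_loop t)).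
Qed.

Lemma map_arc_asym x y : map_arc x y -> ~~ map_arc y x.
Proof.
case/map_arcP=> t [sx sy ot]; apply/map_arcP=> -[t' [sy' sx' ot']].
have E : t' = o t by apply: s_inj; rewrite ?oK ?sy' ?sx' ?sx ?sy.
by rewrite E out_o ot in ot'.
Qed.

Definition map_ograph : ograph := OGraph map_arc_irr map_arc_asym.

Lemma map_arcE t : @arc map_ograph (s t) (s (o t)) = out t.
Proof.
apply/map_arcP/idP => [[t' [st sot ot']]|ot]; last by exists t.
by rewrite -(s_inj st sot).
Qed.

Lemma map_edge t : @sedge (underlying map_ograph) (s t) (s (o t)).
Proof.
apply/orP; have [ot|ot] := boolP (out t); first by left; rewrite map_arcE.
by right; have := map_arcE (o t); rewrite oK out_o ot.
Qed.

Lemma map_edgeP x y : @sedge (underlying map_ograph) x y ->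
  exists2 t, s t = x & s (o t) = y.
Proof.
case/orP=> /map_arcP[t [st sot _]]; first by exists t.
by exists (o t); rewrite ?oK.
Qed.

Lemma map_outdegree x :
  @outdegree map_ograph x = #|[set t | (s t == x) && out t]|.
Proof.
rewrite -(@card_in_imset _ _ (fun t => s (o t))).
  apply: eq_card => y; rewrite inE; apply/map_arcP/imsetP.
    by case=> t [st sot ot]; exists t; rewrite ?inE ?st ?eqxx.
  by case=> t; rewrite inE => /andP[/eqP st ot] ->; exists t.
move=> t t'; rewrite !inE => /andP[/eqP st _] /andP[/eqP st' _].
by apply: s_inj; rewrite st st'.
Qed.

Lemma map_indegree x :
  @indegree map_ograph x = #|[set t | (s t == x) && ~~ out t]|.
Proof.
rewrite -(@card_in_imset _ _ (fun t => s (o t))).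
  apply: eq_card => y; rewrite inE; apply/map_arcP/imsetP.
    case=> t [st sot ot]; exists (o t); rewrite ?oK //.
    by rewrite inE sot eqxx out_o negbK.
  case=> t; rewrite inE => /andP[/eqP st ot] ->; exists (o t).
  by rewrite oK st out_o ot.
move=> t t'; rewrite !inE => /andP[/eqP st _] /andP[/eqP st' _].
by apply: s_inj; rewrite st st'.
Qed.

(** [mate] exchanges the incoming and the outgoing half-edges at each vertex. *)
Lemma map_balanced (mate : T -> T) : injective mate ->
  (forall t, s (mate t) = s t) -> (forall t, out (mate t) = ~~ out t) ->
  forall x, @indegree map_ograph x = @outdegree map_ograph x.
Proof.
move=> mate_inj s_mate out_mate x; rewrite map_indegree map_outdegree.
rewrite -(card_preimset _ mate_inj); apply: eq_card => t.
by rewrite !inE s_mate out_mate negbK.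
Qed.

End MapGraph.

Lemma oeulerian_even (G : ograph) : oeulerian G -> eulerian (underlying G).
Proof.
case=> cG bal; split=> // x; rewrite /degree.
have -> : [set y | @sedge (underlying G) x y]
    = [set y | arc x y] :|: [set y | arc y x].
  by apply/setP=> y; rewrite !inE.
rewrite cardsU (_ : _ :&: _ = set0); last first.
  apply/setP=> y; rewrite !inE; apply/negP=> /andP[xy].
  by rewrite (negbTE (arc_asym xy)).
by rewrite cards0 subn0 -/(outdegree x) -/(indegree x) bal addnn odd_double.
Qed.

(** * Coning the faces of a drawing *)

Section Cone.
Variables (H : sgraph) (R : rotation_system H) (S : {set H}) (a : rel H).
Hypotheses (tvcH : two_vertex_connected H) (sphR : spherical R)
  (indS : independent S) (indSC : independent (~: S))
  (a_edge : forall x y, a x y || a y x = sedge x y)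
  (a_asym : forall x y, a x y -> ~~ a y x).

Local Notation src := (@dart_source H).
Local Notation opp := (@dart_opp H).
Local Notation rot := (rotation R).
Local Notation next := (face_perm R).
Local Notation prev := ((face_perm R)^-1)%g.

Let next_src d : src (next d) = src (opp d).
Proof. by rewrite permM opp_permE rotation_source. Qed.

Lemma orientN x y : sedge x y -> a y x = ~~ a x y.
Proof.
rewrite -a_edge => /orP[xy|yx]; first by rewrite xy (negbTE (a_asym xy)).
by rewrite yx (negbTE (a_asym yx)).
Qed.

Lemma opp_side d : (src (opp d) \in S) = (src d \notin S).
Proof.
have [dS|dS] := boolP (src d \in S); have dd := dart_edge d.
  by apply: contraTF dd => oS; apply: (independentP _ indS).
by apply: contraTT dd => oS; apply: (independentP _ indSC); rewrite inE.
Qed.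

Definition face_of (d : dart H) : {F : {set dart H} | F \in faces R} :=
  exist (fun F => F \in faces R) (porbit next d) (imset_f _ isT).

Lemma face_of_next d : face_of (next d) = face_of d.
Proof. by apply: val_inj; rewrite /= -[in LHS](expg1 next) porbit_perm. Qed.

Lemma face_of_prev d : face_of (prev d) = face_of d.
Proof. by rewrite -face_of_next permKV. Qed.

Lemma face_of_orbit d d' : face_of d = face_of d' -> d' \in porbit next d.
Proof. by move/(congr1 val)=> /= E; rewrite E porbit_id. Qed.

Lemma face_ofP F : exists d, face_of d = F.
Proof.
case: F => F FR; have /imsetP[d _ E] := FR.
by exists d; apply: val_inj; rewrite /= E.
Qed.

(** The half-edges of the cone over the faces.  The dart [d] stands at a corner
    of its face, between [rot^-1 d] and [d]; the new edge drawn in this corner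
    is [Up d] seen from the old vertex and [Down d] seen from the apex. *)
Definition half : finType := (dart H + (dart H + dart H))%type.
Definition Old (d : dart H) : half := inl d.
Definition Up (d : dart H) : half := inr (inl d).
Definition Down (d : dart H) : half := inr (inr d).

Definition cone_vertex : finType :=
  (H + {F : {set dart H} | F \in faces R})%type.

Definition half_src (t : half) : cone_vertex :=
  match t with
  | inl d => inl (src d) | inr (inl d) => inl (src d)
  | inr (inr d) => inr (face_of d)
  end.

Definition half_opp_fun (t : half) : half :=
  match t with
  | inl d => Old (opp d) | inr (inl d) => Down d | inr (inr d) => Up d
  end.

Lemma half_opp_funK : involutive half_opp_fun.
Proof. by case=> [d|[d|d]] //=; rewrite dart_oppK. Qed.

Definition half_opp : {perm half} := perm (inv_inj half_opp_funK).

Definition half_rot_fun (t : half) : half :=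
  match t with
  | inl d => Up (rot d) | inr (inl d) => Old d | inr (inr d) => Down (prev d)
  end.

Lemma half_rot_inj : injective half_rot_fun.
Proof.
by move=> [d|[d|d]] [d'|[d'|d']] //= [] => [/perm_inj|->|/perm_inj] // ->.
Qed.

Definition half_rot : {perm half} := perm half_rot_inj.

(** The triangle of a dart leaving [S] is oriented as a directed cycle, in the
    direction of its old edge.  At a corner in [S] this is the triangle of [d]
    itself, so the new edge goes up when the old one comes in; at a corner
    outside [S] it is the triangle of [prev d], and the new edge again goes up
    when the old one comes in. *)
Definition up_out (d : dart H) : bool :=
  if src d \in S then a (src (opp d)) (src d) else a (src (prev d)) (src d).

Definition half_out (t : half) : bool :=
  match t with
  | inl d => a (src d) (src (opp d)) | inr (inl d) => up_out d
  | inr (inr d) => ~~ up_out d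
  end.

(** The other half-edge at the same vertex of the oriented triangle of [t]. *)
Definition mate (t : half) : half :=
  match t with
  | inl d => if src d \in S then Up d else Up (rot d)
  | inr (inl d) => Old (if src d \in S then d else (rot^-1)%g d)
  | inr (inr d) => Down (if src d \in S then next d else prev d)
  end.

Lemma prev_src d : src (opp (prev d)) = src d.
Proof. by rewrite -next_src permKV. Qed.

Lemma rotV_src d : src ((rot^-1)%g d) = src d.
Proof. by rewrite -(rotation_source R) permKV. Qed.

Lemma prevE d : prev d = opp ((rot^-1)%g d).
Proof.
by apply: (@perm_inj _ next); rewrite permKV permM opp_permE dart_oppK permKV.
Qed.

Lemma next_side d : (src (next d) \in S) = (src d \notin S).
Proof. by rewrite next_src opp_side. Qed.

Lemma prev_side d : (src (prev d) \in S) = (src d \notin S).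
Proof. by rewrite -[in RHS](permKV next d) next_side negbK. Qed.

Lemma mateK : involutive mate.
Proof.
case=> [d|[d|d]] /=; have [dS|dS] := boolP (src d \in S); rewrite /= ?dS //=.
- by rewrite rotation_source (negbTE dS) permK.
- by rewrite rotV_src (negbTE dS) permKV.
- by rewrite next_side dS /= permK.
- by rewrite prev_side dS permKV.
Qed.

Lemma mate_src t : half_src (mate t) = half_src t.
Proof.
case: t => [d|[d|d]] /=; case: ifP => _ //=.
- by rewrite rotation_source.
- by rewrite rotV_src.
- by rewrite face_of_next.
- by rewrite face_of_prev.
Qed.

Lemma mate_out t : half_out (mate t) = ~~ half_out t.
Proof.
case: t => [d|[d|d]] /=; case: ifP => dS /=; rewrite /up_out ?dS.
- exact/orientN/dart_edge.
- rewrite rotation_source dS prevE permK.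
  by rewrite (orientN (dart_edge d)).
- by apply: orientN; rewrite sedge_sym dart_edge.
- by rewrite prevE -(rotV_src d); apply: orientN; rewrite sedge_sym dart_edge.
- rewrite next_side dS /= permK next_src negbK.
  by rewrite -(orientN (dart_edge d)).
- rewrite prev_side dS /= prev_src negbK -orientN // sedge_sym.
  by rewrite -(prev_src d) dart_edge.
Qed.

Let H2 : 1 < #|H|. Proof. by case/and3P: tvcH. Qed.
Let cH : connected H. Proof. by case/and3P: tvcH. Qed.

Lemma half_oppK : involutive half_opp.
Proof. by move=> t; rewrite !permE half_opp_funK. Qed.

Lemma half_loop t : half_src t != half_src (half_opp t).
Proof.
rewrite permE; case: t => [d|[d|d]] //=.
by apply: contraTneq (dart_edge d) => -[->]; rewrite sedge_irr.
Qed.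

Lemma apex_inj d d' :
  inr (face_of d) = inr (face_of d') :> cone_vertex -> d' \in porbit next d.
Proof. by move=> E; apply: face_of_orbit; congruence. Qed.

(** The cone is a simple graph: by [face_visits_once], a corner of [H] is
    determined by its vertex and its face. *)
Lemma half_inj t t' : half_src t = half_src t' ->
  half_src (half_opp t) = half_src (half_opp t') -> t = t'.
Proof.
rewrite !permE.
case: t t' => [d|[d|d]] [d'|[d'|d']] //=.
- by case=> E [E']; rewrite (dart_eq E E').
- move=> [E] /apex_inj E'.
  by rewrite (face_visits_once tvcH sphR E E').
- move=> /apex_inj E' [E].
  by rewrite (face_visits_once tvcH sphR E E').
Qed.

Lemma half_out_opp t : half_out (half_opp t) = ~~ half_out t.
Proof.
rewrite permE; case: t => [d|[d|d]] /=; rewrite ?negbK ?dart_oppK //.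
exact/orientN/dart_edge.
Qed.

Lemma half_rot_src t : half_src (half_rot t) = half_src t.
Proof.
rewrite permE; case: t => [d|[d|d]] //=; first by rewrite rotation_source.
by rewrite face_of_prev.
Qed.

Lemma half_rot_orbit t t' :
  half_src t = half_src t' -> t' \in porbit half_rot t.
Proof.
have old_up d : Up (rot d) \in porbit half_rot (Old d).
  by have := porbitS half_rot (Old d); rewrite permE.
have up_old d : Old d \in porbit half_rot (Up d).
  by have := porbitS half_rot (Up d); rewrite permE.
have olds d d' : src d = src d' -> Old d' \in porbit half_rot (Old d).
  move/(rotation_orbit R).
  apply: (porbit_ind (P := fun d' => Old d' \in porbit half_rot (Old d))).
    exact: porbit_id.
  by move=> e IH; apply: porbit_trans IH (porbit_trans (old_up e) (up_old _)).
have ups d d' : src d = src d' -> Up d' \in porbit half_rot (Up d).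
  move=> E; apply: porbit_trans (up_old d) _.
  have := old_up ((rot^-1)%g d'); rewrite permKV; apply: porbit_trans.
  by apply: olds; rewrite rotV_src.
case: t t' => [d|[d|d]] [d'|[d'|d']] //=.
- by case; apply: olds.
- move=> [E]; apply: porbit_trans (olds _ _ E) _.
  by rewrite porbit_sym up_old.
- by move=> [E]; apply: porbit_trans (up_old d) (olds _ _ E).
- by case; apply: ups.
- move/esym/apex_inj; rewrite porbit_sym -porbitV.
  apply: (porbit_ind (P := fun d' => Down d' \in porbit half_rot (Down d))).
    exact: porbit_id.
  move=> e IH; apply: porbit_trans IH _.
  by have := porbitS half_rot (Down e); rewrite permE.
Qed.

Definition cone : ograph := map_ograph half_oppK half_loop half_inj half_out_opp.

Lemma cone_arc_old x y : @arc cone (inl x) (inl y) = a x y.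
Proof.
apply/map_arcP/idP => [[t]|axy].
  by rewrite permE; case: t => [d|[d|d]] [] //= [<-] [<-].
have xy : sedge x y by rewrite -a_edge axy.
by exists (Old (mk_dart xy)); rewrite permE.
Qed.

Lemma cone_edge_old x y : @sedge (underlying cone) (inl x) (inl y) = sedge x y.
Proof. by rewrite /sedge /= /under_edge !cone_arc_old a_edge. Qed.

Lemma cone_edge_apex F F' : @sedge (underlying cone) (inr F) (inr F') = false.
Proof.
apply/negP=> /map_edgeP[t].
by case: t => [d|[d|d]] //= _; rewrite permE.
Qed.

Lemma cone_edge_half t :
  @sedge (underlying cone) (half_src t) (half_src (half_opp t)).
Proof. exact: map_edge. Qed.

Lemma card_half : #|half| = 3 * #|dart H|.
Proof. by rewrite !card_sum !mulSn mul0n addn0. Qed.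

Lemma card_cone : #|cone| = #|H| + #|faces R|.
Proof. by rewrite card_sum card_sig. Qed.

Lemma face_exists : 0 < #|faces R|.
Proof.
have [x _] : exists x : H, x \in predT by apply/card_gt0P; apply: ltnW.
have [y xy] := connected_neighbor cH H2 x.
by apply/card_gt0P; exists (porbit next (mk_dart xy)); apply: imset_f.
Qed.

Lemma cone_connected : connected (underlying cone).
Proof.
have [x0 _] : exists x : H, x \in predT by apply/card_gt0P; apply: ltnW.
have eC := @sedge_connect_sym (underlying cone).
have old x y : connect (@sedge (underlying cone)) (inl x) (inl y).
  apply: (connect_homo (e := sedge) (f := inl)) (connected_connect cH x y).
  by move=> u v uv; apply: connect1; rewrite cone_edge_old.
have to_x0 v : connect (@sedge (underlying cone)) (inl x0) v.
  case: v => [x|F]; first exact: old.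
  have [d <-] := face_ofP F; apply: connect_trans (old x0 (src d)) (connect1 _).
  by have := cone_edge_half (Up d); rewrite permE.
apply: (@connectedI (underlying cone) (inl x0)) => u v.
by apply: connect_trans (to_x0 v); rewrite eC.
Qed.

Lemma cone_triangulation : planar_triangulation (underlying cone).
Proof.
have F1 := face_exists; have C3 : 2 < #|cone| by rewrite card_cone; lia.
have [|||||R' [facesR' oppR' R'3]] :=
  @abstract_map (underlying cone) half half_rot half_opp half_src half_oppK.
- exact: cone_edge_half.
- exact: map_edgeP.
- exact: half_inj.
- exact: half_rot_src.
- exact: half_rot_orbit.
pose turn := (half_opp * half_rot)%g.
have turn_old d : turn (Old d) = Up (next d).
  by rewrite permM [half_opp _]permE [half_rot _]permE /= permM opp_permE.
have turn_up d : turn (Up d) = Down (prev d).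
  by rewrite permM [half_opp _]permE [half_rot _]permE.
have turn_down d : turn (Down d) = Old d.
  by rewrite permM [half_opp _]permE [half_rot _]permE.
(* The triangle of [d] is made of [Old d], [Up (next d)] and [Down d]. *)
have orbit3 t : #|porbit turn t| = 3.
  apply: card_porbit3; case: t => [d|[d|d]].
  - by rewrite turn_old.
  - by rewrite turn_up.
  - by rewrite turn_down.
  - by rewrite turn_old turn_up turn_down permK.
  - by rewrite turn_up turn_down turn_old permKV.
  - by rewrite turn_down turn_old turn_up permK.
split=> //; first exact: cone_connected.
exists R'; split; last exact: R'3.
apply/spherical_connected; [exact: cone_connected|exact: ltnW|].
rewrite facesR' oppR' card_cone -/turn.
have := card_porbits_uniform orbit3; rewrite card_half.
have opp2 t : #|porbit half_opp t| = 2.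
  apply: card_porbit2 (half_oppK t).
  by apply: contraNneq (half_loop t) => ->.
have := card_porbits_uniform opp2; rewrite card_half.
have := card_dart H; have := proj1 (spherical_connected R cH H2) sphR.
by lia.
Qed.

Lemma cone_eulerian : oeulerian cone.
Proof.
split; first exact: cone_connected.
apply: (map_balanced (mate := mate)).
- exact: (inv_inj mateK).
- exact: mate_src.
- exact: mate_out.
Qed.

(** The three parts as fibers of one map, [None] standing for the apexes. *)
Definition side (v : cone_vertex) : option bool :=
  if v is inl x then Some (x \in S) else None.

Definition part (c : option bool) : {set cone_vertex} := [set v | side v == c].

Lemma side_onto c : exists v, side v = c.
Proof.
have [x0 _] : exists x : H, x \in predT by apply/card_gt0P; apply: ltnW.
have [y0 xy] := connected_neighbor cH H2 x0.
have y_side : (y0 \in S) = (x0 \notin S) := opp_side (mk_dart xy).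
case: c => [b|]; last by exists (inr (face_of (mk_dart xy))).
have [xb|xb] := eqVneq (x0 \in S) b; first by exists (inl x0); rewrite /= xb.
by exists (inl y0); rewrite /= y_side; case: b xb => /=; case: (x0 \in S).
Qed.

Lemma part_inj : injective part.
Proof.
move=> c c' /setP E; have [v vc] := side_onto c.
by have := E v; rewrite !inE vc eqxx => /esym/eqP.
Qed.

Lemma cone_tripartition :
  @tripartition (underlying cone) [set part c | c : option bool].
Proof.
split.
- apply/and3P; split.
  + apply/eqP/setP=> v; rewrite inE; apply/bigcupP.
    by exists (part (side v)); rewrite ?imset_f ?inE.
  + apply/trivIsetP=> _ _ /imsetP[c _ ->] /imsetP[c' _ ->].
    apply: contraR => /pred0Pn[v /andP[/=]].
    by rewrite !inE => /eqP-> /eqP->.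
  + apply/imsetP=> -[c _ /setP E]; have [v vc] := side_onto c.
    by have := E v; rewrite !inE vc eqxx.
- by rewrite card_imset ?card_option ?card_bool //; apply: part_inj.
- move=> _ /imsetP[c _ ->]; apply/independentP=> u v; rewrite !inE.
  case: u v => [x|F] [y|F'] /eqP <- //; last by rewrite cone_edge_apex.
  rewrite cone_edge_old => /eqP[yx].
  have [xS|xS] := boolP (x \in S).
    by apply: (independentP _ indS); rewrite // yx.
  by apply: (independentP _ indSC); rewrite inE // yx.
Qed.

Lemma part_union v :
  v \in part (Some true) :|: part (Some false) <-> exists x : H, inl x = v.
Proof.
split; last by case=> x <-; rewrite !inE /=; case: (x \in S).
by case: v => [x|F]; [exists x|rewrite !inE].
Qed.

End Cone.

(** * The two equivalences *)

Lemma cone_completion (H : sgraph) (a : rel H) :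
  two_vertex_connected H -> bipartite H -> planar H ->
  (forall x y, a x y || a y x = sedge x y) ->
  (forall x y, a x y -> ~~ a y x) ->
  exists (G : ograph) (P : {set {set underlying G}}) (A B : {set underlying G}),
    [/\ oriented_planar_triangulation G, oeulerian G, tripartition P,
        [/\ A \in P, B \in P & A != B] &
        exists f : H -> G, [/\ injective f,
          forall v, v \in A :|: B <-> exists x, f x = v &
          forall x y, arc (f x) (f y) = a x y]].
Proof.
move=> tvcH [S [indS indSC]] [R sphR] a_edge a_asym.
exists (cone S tvcH sphR a_edge a_asym),
  [set part R S c | c : option bool],
  (part R S (Some true)), (part R S (Some false)); split.
- exact: cone_triangulation.
- exact: cone_eulerian.
- exact: cone_tripartition.
- split; try exact: imset_f.
  by rewrite (inj_eq (part_inj tvcH indS indSC)).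
- exists inl; split; first by move=> x y [].
    exact: part_union.
  exact: cone_arc_old.
Qed.

(** The complement [C] of the two chosen parts is the third part, and every
    triangle meets it because the other two parts are independent. *)
Lemma deletion (G H : sgraph) (P : {set {set G}}) (A B : {set G}) (f : H -> G) :
  planar_triangulation G -> tripartition P ->
  A \in P -> B \in P -> A != B ->
  injective f -> (forall v, v \in A :|: B <-> exists x, f x = v) ->
  (forall x y, sedge (f x) (f y) = sedge x y) ->
  two_vertex_connected H /\ bipartite H /\ planar H.
Proof.
case=> connG G3 [R [sphR faces3]] [partP P3 indP] AP BP AB f_inj f_AB f_edge.
have [/eqP covP /trivIsetP disjP P0] := and3P partP.
have ABdisj := disjP _ _ AP BP AB.
have [D PD] : exists D, P = [set A; B; D].
  have: #|P :\: [set A; B]| == 1.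
    rewrite cardsD (setIidPr _) ?cards2 ?AB ?P3 //.
    by apply/subsetP=> X; rewrite !inE => /orP[]/eqP->.
  case/cards1P=> D E; exists D; apply/setP=> X; have /setP/(_ X) := E.
  rewrite !inE; have [->|_] := eqVneq X A; first by rewrite AP.
  by have [->|_] := eqVneq X B; first by rewrite BP.
set C := ~: (A :|: B).
have CD v : v \in C -> v \in D.
  have : v \in cover P by rewrite covP inE.
  case/bigcupP=> X; rewrite PD !inE -orbA.
  by case/or3P=> /eqP-> -> //; rewrite ?orbT.
have indC : independent C.
  have indD : independent D by apply: indP; rewrite PD !inE eqxx orbT.
  apply/independentP=> x y /CD xD /CD; exact: (independentP _ indD).
have indA := independentP _ (indP _ AP); have indB := independentP _ (indP _ BP).
have C_triangle x y z : sedge x y -> sedge y z -> sedge z x ->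
    x \notin C -> y \notin C -> z \in C.
  rewrite !inE !negbK => xy yz zx xAB yAB; apply/norP; split; apply/negP => zX.
    case/orP: xAB => [xA|xB]; first by move: zx; apply/negP/indA.
    case/orP: yAB => [yA|yB]; first by move: yz; apply/negP/indA.
    by move: xy; apply/negP/indB.
  case/orP: xAB => [xA|xB]; last by move: zx; apply/negP/indB.
  case/orP: yAB => [yA|yB]; last by move: yz; apply/negP/indB.
  by move: xy; apply/negP/indA.
have fC x : f x \notin C by rewrite inE negbK; apply/f_AB; exists x.
have f_surj z : z \notin C -> exists x, f x = z by rewrite inE negbK => /f_AB.
have nonempty X : X \in P -> exists x, x \in X.
  move=> XP; apply/set0Pn; by apply: contraNneq P0 => <-.
have H2 : 1 < #|H|.
  have [u uA] := nonempty _ AP; have [v vB] := nonempty _ BP.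
  have [x fx] : exists x, f x = u by apply/f_AB; rewrite inE uA.
  have [y fy] : exists y, f y = v by apply/f_AB; rewrite inE vB orbT.
  apply/card_gt1P; exists x, y; split=> //; apply/eqP => xy.
  by have := disjointFr ABdisj uA; rewrite -fx xy fy vB.
split; [|split].
- exact: (deletion_two_vertex_connected faces3 connG indC f_inj).
- exists (f @^-1: A); split; apply/independentP=> x y; rewrite !inE -f_edge.
    exact: indA.
  have inB z : f z \notin A -> f z \in B.
    by have := fC z; rewrite inE negbK inE => /orP[->|].
  by move=> /inB xB /inB yB; apply: indB.
- exact: (deletion_planar faces3 connG indC C_triangle f_inj f_edge fC f_surj H2
    sphR (ltnW G3)).
Qed.

Lemma embed_bij (T U : finType) (S : {set U}) (f : T -> U) :
  injective f -> (forall v, v \in S <-> exists x, f x = v) ->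
  exists g : T -> {v | v \in S}, bijective g /\ forall x, val (g x) = f x.
Proof.
move=> f_inj fS; have fS' x : f x \in S by apply/fS; exists x.
pose g x : {v | v \in S} := exist _ (f x) (fS' x); exists g; split=> //.
apply: inj_card_bij => [x y /(congr1 val)/f_inj//|].
rewrite card_sig -(card_codom f_inj); apply/subset_leq_card/subsetP=> v.
by move/fS=> [x <-]; apply: codom_f.
Qed.

Lemma bij_embed (T U : finType) (S : {set U}) (g : T -> {v | v \in S}) :
  bijective g -> injective (val \o g) /\
  forall v, v \in S <-> exists x, (val \o g) x = v.
Proof.
case=> h gK hK; split; first by move=> x y /val_inj/(can_inj gK).
move=> v; split=> [vS|[x <-]]; last exact: valP.
by exists (h (exist _ v vS)); rewrite /= hK.
Qed.

Theorem mainTheorem6 :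
  (forall H : sgraph,
     (exists (G : sgraph) (P : {set {set G}}) (A B : {set G}),
        planar_triangulation G /\ eulerian G /\
        tripartition P /\ A \in P /\ B \in P /\ A != B /\
        sgraph_iso H (induced (A :|: B)))
     <->
     (two_vertex_connected H /\ bipartite H /\ planar H))
  /\
  (forall H : ograph,
     (exists (G : ograph) (P : {set {set underlying G}})
             (A B : {set underlying G}),
        oriented_planar_triangulation G /\ oeulerian G /\
        tripartition P /\ A \in P /\ B \in P /\ A != B /\
        ograph_iso H (@oinduced G (A :|: B)))
     <->
     (two_vertex_connected (underlying H) /\ bipartite (underlying H) /\
      planar (underlying H))).
Proof.
split=> H; split.
- case=> G [P [A [B [triG [_ [triP [AP [BP [AB [g [g_bij g_edge]]]]]]]]]]].
  have [f_inj f_AB] := bij_embed g_bij.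
  exact: (deletion triG triP AP BP AB f_inj f_AB g_edge).
- case=> tvcH [bipH planH]; have [S [indS indSC]] := bipH.
  pose a : rel H := fun x y => (x \in S) && sedge x y.
  have side x y : sedge x y -> (y \in S) = (x \notin S).
    move=> xy; have [xS|xS] := boolP (x \in S).
      by apply: contraTF xy; apply: (independentP _ indS).
    by apply: contraTT xy => yS; apply: (independentP _ indSC); rewrite inE.
  have a_edge x y : a x y || a y x = sedge x y.
    rewrite /a [sedge y x]sedge_sym; have [xy|] := boolP (sedge x y).
      by rewrite (side _ _ xy); case: (x \in S).
    by rewrite !andbF.
  have a_asym x y : a x y -> ~~ a y x.
    by case/andP=> xS xy; rewrite /a (side _ _ xy) xS.
  have [G [P [A [B [triG eulG triP [AP BP AB] [f [f_inj f_AB f_arc]]]]]]] :=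
    cone_completion tvcH bipH planH a_edge a_asym.
  exists (underlying G), P, A, B; do !split=> //; first exact: (oeulerian_even eulG).1.
    exact: (oeulerian_even eulG).2.
  have [g [g_bij gf]] := embed_bij f_inj f_AB; exists g; split=> // x y.
  by rewrite /sedge /= /induced_edge !gf /= /under_edge !f_arc a_edge.
- case=> G [P [A [B [triG [_ [triP [AP [BP [AB [g [g_bij g_arc]]]]]]]]]]].
  have [f_inj f_AB] := bij_embed g_bij.
  apply: (@deletion (underlying G) (underlying H) P A B _ triG triP AP BP AB f_inj f_AB).
  by move=> x y; rewrite /sedge /= /under_edge -!g_arc.
- case=> tvcH [bipH planH].
  have [G [P [A [B [triG eulG triP [AP BP AB] [f [f_inj f_AB f_arc]]]]]]] :=
    cone_completion (H := underlying H) tvcH bipH planH (a := @arc H) (fun _ _ => erefl)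
      (@arc_asym H).
  exists G, P, A, B; do ![split=> //].
  have [g [g_bij gf]] := embed_bij f_inj f_AB; exists g; split=> // x y.
  by rewrite -f_arc /arc /= /oinduced_arc !gf.
Qed.
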